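(* Suppose $|a|_p<\alpha<\beta$. Put $\check\alpha(x)=|f(x)|_p$ for $x\in S_\alpha(0)\setminus\{\hat x_1\}$, $\check\beta(x)=|f(x)|_p$ for $x\in S_\beta(0)\setminus\{\hat x_2\}$, and $\check a(x)=|f(x)|_p$ for $x\in S_{\alpha\beta/|a|_p}(0)$. Let $x\in S_r(0)\setminus\mathcal P$. Then the $p$-adic dynamical system generated by $f$ has the following properties. 1. $SI(x_1)=U_\alpha(0)$. 2. If $\alpha<r<\beta$, then $f(x)\in S_\alpha(0)$. 3. Let $r>\beta$. Then for every $n\ge1$: $f^n(x)\in S_{\alpha\beta/r}(0)$ if $\alpha<r<\alpha\beta/|a|_p$; $f^n(x)\in S_{\check a(x)}(0)$ if $r=\alpha\beta/|a|_p$; $f^n(x)\in S_{|a|_p}(0)$ if $r>\alpha\beta/|a|_p$. 4. Let $x\in S_\alpha(0)\setminus\mathcal P$. (4.1) If $\check\alpha(x)=\alpha$, then $f(x)\in S_\alpha(0)$. (4.2) If $\alpha<\check\alpha(x)<\beta$, then $f^2(x)\in S_\alpha(0)$. (4.3) If $\check\alpha(x)=\beta$, then $f(x)\in S_\beta(0)$. (4.4) If $\check\alpha(x)>\beta$, then for every $n\ge2$: $f^n(x)\in S_{\alpha\beta/\check\alpha(x)}(0)$ if $\alpha<\check\alpha(x)<\alpha\beta/|a|_p$; $f^n(x)\in S_{\check a(f(x))}(0)$ if $\check\alpha(x)=\alpha\beta/|a|_p$; $f^n(x)\in S_{|a|_p}(0)$ if $\check\alpha(x)>\alpha\beta/|a|_p$.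 5. Let $x\in S_\beta(0)\setminus\mathcal P$. (5.1) If $\check\beta(x)=\alpha$, then $f(x)\in S_\alpha(0)$. (5.2) If $\alpha<\check\beta(x)<\beta$, then $f^2(x)\in S_\alpha(0)$. (5.3) If $\check\beta(x)=\beta$, then $f(x)\in S_\beta(0)$. (5.4) If $\check\beta(x)>\beta$, then for every $n\ge2$: $f^n(x)\in S_{\alpha\beta/\check\beta(x)}(0)$ if $\alpha<\check\beta(x)<\alpha\beta/|a|_p$; $f^n(x)\in S_{\check a(f(x))}(0)$ if $\check\beta(x)=\alpha\beta/|a|_p$; $f^n(x)\in S_{|a|_p}(0)$ if $\check\beta(x)>\alpha\beta/|a|_p$. 6. (6.1) $x_2\in S_\beta(0)$. (6.2) The fixed point $x_2$ is a repeller and the inequality $|f(x)-x_2|_p>|x-x_2|_p$ holds for $x\in U_\beta(x_2)\setminus\mathcal P$, $x\neq x_2$.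
   Context: $p$ is a prime and $\mathbb C_p$ is the field of complex $p$-adic numbers with norm $|\cdot|_p$. Let $a,b,d\in\mathbb C_p$ with $ab\neq0$, $a\ne d$, and $$f(x)=\frac{ax^2+bx}{x^2+dx+b},\qquad x\in\mathbb C_p\setminus\{\hat x_1,\hat x_2\},$$ where $\hat x_1,\hat x_2\in\mathbb C_p$ are the two (possibly equal) roots of $x^2+dx+b$. Put $\alpha=|\hat x_1|_p$, $\beta=|\hat x_2|_p$, labelled so that $\alpha\le\beta$. Standing assumption: $f$ has the two distinct fixed points $x_1=0$ and $x_2=a-d$ (in particular $x_2\notin\{\hat x_1,\hat x_2\}$, i.e. $b+a(a-d)\neq0$). $\mathcal P=\{x\in\mathbb C_p:\exists n\in\mathbb N\cup\{0\},\ f^n(x)\in\{\hat x_1,\hat x_2\}\}$, where $f^n$ is the $n$-th iterate ($f^0=\mathrm{id}$). For $c\in\mathbb C_p$, $r\geq 0$: $U_r(c)=\{x:|x-c|_p<r\}$, $V_r(c)=\{x:|x-c|_p\le r\}$, $S_r(c)=\{x:|x-c|_p=r\}$ (so $S_0(0)=\{0\}$). A fixed point $x_0$ is attractive, indifferent, repeller if $|f'(x_0)|_p<1$, $=1$, $>1$ respectively. A sphere $S$ is invariant if $f$ is defined on $S$ and $f(S)\subset S$. An open ball $U_r(x_0)$ about a fixed point $x_0$ is a Siegel disk if every sphere $S_\rho(x_0)$, $0<\rho<r$, is invariant; $SI(x_0)$ is the union of all Siegel disks centred at $x_0$ (the maximal Siegel disk). *)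

(* Defs.v *)
From HB Require Import structures.
From mathcomp Require Import all_boot all_order all_algebra.
From mathcomp Require Import boolp classical_sets reals.

Set Implicit Arguments.
Unset Strict Implicit.
Unset Printing Implicit Defensive.

Import Order.TTheory GRing.Theory Num.Theory.
Local Open Scope classical_set_scope.
Local Open Scope ring_scope.

Section PadicComplexNumbers.
Variables (R : realType) (p : nat).

Definition padic_norm (q : rat) : R :=
  if q == 0 then 0
  else p%:R ^+ logn p `|denq q|%N / p%:R ^+ logn p `|numq q|%N.

Variables (K : fieldType) (nrm : K -> R).

Definition cauchy_seq (u : nat -> K) : Prop :=
  forall e : R, 0 < e -> exists N : nat, forall m n : nat,
    (N <= m)%N -> (N <= n)%N -> nrm (u m - u n) < e.

Definition cvg_seq (u : nat -> K) (l : K) : Prop :=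
  forall e : R, 0 < e -> exists N : nat, forall n : nat,
    (N <= n)%N -> nrm (u n - l) < e.

(* The topological closure of the prime field in K.  If K is complete and nrm
   extends the p-adic norm of the rationals, this is the completion Q_p. *)
Definition Qp : set K :=
  [set x | forall e : R, 0 < e -> exists q : rat, nrm (x - ratr q) < e].

Definition Qp_algebraic : set K :=
  [set x | exists P : {poly K},
     [/\ P != 0, forall i : nat, Qp P`_i & root P x]].

(* (K, nrm) is the field C_p, the completion of an algebraic closure of Q_p:
   nrm is a complete ultrametric absolute value extending the p-adic norm of
   the rationals (so that K contains Q_p), the elements algebraic over Q_p form
   an algebraically closed field, and that field is dense in K.  These
   properties determine (K, nrm) up to isometric isomorphism. *)
Record is_padic_complex : Prop := IsPadicComplex {
  nrm_ge0 : forall x, 0 <= nrm x;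
  nrm_eq0 : forall x, nrm x = 0 -> x = 0;
  nrmM : forall x y, nrm (x * y) = nrm x * nrm y;
  nrm_ultra : forall x y, nrm (x + y) <= Num.max (nrm x) (nrm y);
  nrm_rat : forall q : rat, nrm (ratr q) = padic_norm q;
  nrm_complete : forall u, cauchy_seq u -> exists l, cvg_seq u l;
  Qp_algebraic_closed : forall P : {poly K}, (1 < size P)%N ->
    (forall i : nat, Qp_algebraic P`_i) ->
    exists2 x, Qp_algebraic x & root P x;
  Qp_algebraic_dense : forall (x : K) (e : R), 0 < e ->
    exists2 y, Qp_algebraic y & nrm (x - y) < e
}.

End PadicComplexNumbers.

Section Dynamics.
Variables (R : realType) (K : fieldType) (nrm : K -> R).

Definition Uball (r : R) (c : K) : set K := [set x | nrm (x - c) < r].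
Definition Sphere (r : R) (c : K) : set K := [set x | nrm (x - c) = r].

(* A partial map K -> K is represented by a total function f together with the
   set Z of points where it is not defined; f is arbitrary on Z. *)
Variables (Z : set K) (f : K -> K).

(* The values of f on Z do not matter here: the first n with f^n(x) in Z is
   reached through points where the partial map is defined. *)
Definition singular_orbits : set K := [set x | exists n : nat, Z (iter n f x)].

Definition is_fixed_point (x0 : K) : Prop := ~ Z x0 /\ f x0 = x0.

Definition has_derivative (x0 l : K) : Prop :=
  forall e : R, 0 < e -> exists2 delta : R, 0 < delta &
    forall h : K, h != 0 -> nrm h < delta ->
      ~ Z (x0 + h) /\ nrm ((f (x0 + h) - f x0) / h - l) < e.

Definition is_repeller (x0 : K) : Prop :=
  is_fixed_point x0 /\ exists2 l, has_derivative x0 l & 1 < nrm l.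

Definition invariant_set (S : set K) : Prop :=
  forall x, S x -> ~ Z x /\ S (f x).

Definition is_siegel_disk (x0 : K) (r : R) : Prop :=
  [/\ is_fixed_point x0, 0 < r &
      forall rho : R, 0 < rho -> rho < r -> invariant_set (Sphere rho x0)].

Definition SI (x0 : K) : set K :=
  \bigcup_(r in is_siegel_disk x0) Uball r x0.

End Dynamics.

Section TheMap.
Variables (K : fieldType) (a b d : K).

Definition fmap (x : K) : K := (a * x ^+ 2 + b * x) / (x ^+ 2 + d * x + b).

End TheMap.

(* Main.v *)
Require Import Defs.
From HB Require Import structures.
From mathcomp Require Import all_boot all_order all_algebra.
From mathcomp Require Import boolp classical_sets reals.
From mathcomp Require Import ring.

(** Writing [f x = x (a x + b) / ((x - xh1) (x - xh2))], the ultrametric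
    inequality makes each factor have the norm of its dominant term, so that
    [|f x|] is a function of [|x|] alone off the critical spheres of radii
    [alpha], [beta] and [alpha beta / |a|].  Everything outside the closed ball
    of radius [beta] is sent into the open ball of radius [alpha], where [f]
    preserves the norm.  Near [x2 = a - d] the identity
    [f x - x2 = (x - x2) (d x + b) / ((x - xh1) (x - xh2))] gives expansion:
    the numerator has norm [beta ^ 2], while [|x - xh2| < beta] because
    [x2 - xh2 = a + xh1]. *)

Set Implicit Arguments.
Unset Strict Implicit.
Unset Printing Implicit Defensive.

Import Order.TTheory GRing.Theory Num.Theory.
Local Open Scope classical_set_scope.
Local Open Scope ring_scope.

(** * Ultrametric absolute values on a field *)

Record ultrametric_abs (R : realFieldType) (K : fieldType) (nrm : K -> R) :
    Prop := UltrametricAbs {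
  uabs_ge0 : forall x, 0 <= nrm x;
  uabs_eq0 : forall x, (nrm x == 0) = (x == 0);
  uabsM : forall x y, nrm (x * y) = nrm x * nrm y;
  uabsD : forall x y, nrm (x + y) <= Num.max (nrm x) (nrm y)
}.

Section UltrametricAbsTheory.
Variables (R : realFieldType) (K : fieldType) (nrm : K -> R).
Hypothesis nrmP : ultrametric_abs nrm.

Lemma uabs0 : nrm 0 = 0.
Proof. by apply/eqP; rewrite (uabs_eq0 nrmP). Qed.

Lemma uabs_gt0 x : (0 < nrm x) = (x != 0).
Proof. by rewrite lt_def (uabs_ge0 nrmP) andbT (uabs_eq0 nrmP). Qed.

Lemma uabs1 : nrm 1 = 1.
Proof.
have n1 : nrm 1 != 0 by rewrite (uabs_eq0 nrmP) oner_eq0.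
by apply: (mulfI n1); rewrite -(uabsM nrmP) !mulr1.
Qed.

(** The norm of -1 squares to 1 and is nonnegative, so it is 1. *)
Lemma uabsN x : nrm (- x) = nrm x.
Proof.
have nN1 : nrm (-1) = 1.
  have := uabsM nrmP (-1) (-1); rewrite mulrNN mulr1 uabs1 => /esym/eqP.
  rewrite -expr2 sqrf_eq1 => /orP[/eqP//|/eqP e].
  by have := uabs_ge0 nrmP (-1); rewrite e ler0N1.
by rewrite -mulN1r (uabsM nrmP) nN1 mul1r.
Qed.

Lemma uabsV x : nrm x^-1 = (nrm x)^-1.
Proof.
have [->|x0] := eqVneq x 0; first by rewrite invr0 uabs0 invr0.
have nx0 : nrm x != 0 by rewrite (uabs_eq0 nrmP).
by apply: (mulfI nx0); rewrite -(uabsM nrmP) !divff // uabs1.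
Qed.

Lemma uabs_div x y : nrm (x / y) = nrm x / nrm y.
Proof. by rewrite (uabsM nrmP) uabsV. Qed.

Lemma uabsD_le x y r : nrm x <= r -> nrm y <= r -> nrm (x + y) <= r.
Proof. by move=> xr yr; rewrite (le_trans (uabsD nrmP x y))// ge_max xr. Qed.

Lemma uabsD_lt x y r : nrm x < r -> nrm y < r -> nrm (x + y) < r.
Proof. by move=> xr yr; rewrite (le_lt_trans (uabsD nrmP x y))// gt_max xr. Qed.

(** If [x + y] had norm below [nrm x], then [x = (x + y) - y] would be a sum of two terms of norm
    below [nrm x]. *)
Lemma uabsDl x y : nrm y < nrm x -> nrm (x + y) = nrm x.
Proof.
move=> yx; apply/eqP; rewrite eq_le uabsD_le ?(ltW yx)//= leNgt.
apply/negP => xy_lt.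
have : nrm ((x + y) - y) < nrm x by apply: uabsD_lt; rewrite ?uabsN.
by rewrite addrK ltxx.
Qed.

Lemma uabsDr x y : nrm x < nrm y -> nrm (x + y) = nrm y.
Proof. by rewrite addrC; apply: uabsDl. Qed.

Lemma uabsBl x y : nrm y < nrm x -> nrm (x - y) = nrm x.
Proof. by move=> yx; rewrite uabsDl ?uabsN. Qed.

Lemma uabsBr x y : nrm x < nrm y -> nrm (x - y) = nrm y.
Proof. by move=> xy; rewrite uabsDr ?uabsN. Qed.

End UltrametricAbsTheory.

Lemma padic_complex_ultrametric (R : realType) (p : nat) (K : fieldType)
  (nrm : K -> R) : is_padic_complex p nrm -> ultrametric_abs nrm.
Proof.
case=> ge0 eq0 M D nrmr _ _ _; split=> // x; apply/eqP/eqP => [/eq0//|->].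
(* The value of the norm at 0 is read off from the p-adic norm of the rational 0. *)
have -> : (0 : K) = ratr 0 by rewrite /ratr (numq_int 0) mul0r.
by rewrite nrmr /padic_norm eqxx.
Qed.

(** Evaluating both sides at 0 yields [b], and then evaluating at 1 yields [d]. *)
Lemma monic_quadratic_coefs (K : fieldType) (b d u v : K) :
  'X^2 + d *: 'X + b%:P = ('X - u%:P) * ('X - v%:P) ->
  d = - (u + v) /\ b = u * v.
Proof.
move=> e; have eb : b = u * v.
  have := congr1 (horner^~ 0) e.
  by rewrite !hornerE /= expr0n /= add0r mulrNN.
split=> //; have := congr1 (horner^~ 1) e; rewrite !hornerE /= eb => e1.
have -> : d = (1 ^+ 2 + d + u * v) - 1 - u * v by ring.
by rewrite e1; ring.
Qed.

(** * The map expressed through the roots of its denominator *)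

Section QuadraticMap.
Variables (R : realType) (K : fieldType) (nrm : K -> R).
Hypothesis nrmP : ultrametric_abs nrm.
Variables (a xh1 xh2 : K).

Let b := xh1 * xh2.
Let d := - (xh1 + xh2).
Let f := fmap a b d.
Let Z := [set xh1; xh2].
Let alpha := nrm xh1.
Let beta := nrm xh2.
Let A := nrm a.
Let x2 := a - d.

Hypotheses (a0 : a != 0) (Aalpha : A < alpha) (alphabeta : alpha < beta).

Let A_gt0 : 0 < A. Proof. by rewrite uabs_gt0. Qed.
Let alpha_gt0 : 0 < alpha. Proof. exact: lt_trans Aalpha. Qed.
Let beta_gt0 : 0 < beta. Proof. exact: lt_trans alphabeta. Qed.
Let Abeta : A < beta. Proof. exact: lt_trans alphabeta. Qed.

Let nrmb : nrm b = alpha * beta. Proof. exact: uabsM. Qed.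

Let nrmd : nrm d = beta.
Proof. by rewrite /d (uabsN nrmP) (uabsDr nrmP). Qed.

(** [alpha * beta / A] is the radius at which the terms [a * x] and [b] of the numerator have equal
    norm, so the nonzero root [- b / a] of the numerator lies on this sphere. *)
Let beta_lt_pole : beta < alpha * beta / A.
Proof. by rewrite ltr_pdivlMr // mulrC ltr_pM2r. Qed.

Lemma fmap_factored x : f x = x * (a * x + b) / ((x - xh1) * (x - xh2)).
Proof. by rewrite /f /fmap; congr (_ / _); rewrite /b /d; ring. Qed.

Lemma fmap0 : f 0 = 0.
Proof. by rewrite fmap_factored !mul0r. Qed.

Lemma nrm_fmap x : nrm (f x) =
  nrm x * nrm (a * x + b) / (nrm (x - xh1) * nrm (x - xh2)).
Proof. by rewrite fmap_factored (uabs_div nrmP) !(uabsM nrmP). Qed.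

(** * Norm of [f] on spheres around 0 *)

Lemma nrm_numer x : nrm x < alpha * beta / A -> nrm (a * x + b) = alpha * beta.
Proof.
move=> xlt; rewrite (uabsDr nrmP) ?nrmb//.
by rewrite (uabsM nrmP) mulrC -ltr_pdivlMr.
Qed.

Lemma nrm_fmap_small x : nrm x < alpha -> nrm (f x) = nrm x.
Proof.
move=> xa; have xb := lt_trans xa alphabeta.
rewrite nrm_fmap nrm_numer ?(lt_trans xb)// !(uabsBr nrmP)//.
by rewrite mulfK// mulf_neq0 ?gt_eqF.
Qed.

Lemma nrm_fmap_annulus x : alpha < nrm x -> nrm x < beta -> nrm (f x) = alpha.
Proof.
move=> xa xb; have x0 := lt_trans alpha_gt0 xa.
rewrite nrm_fmap nrm_numer ?(lt_trans xb)// (uabsBl nrmP)// (uabsBr nrmP)//.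
by rewrite mulrCA mulfK// mulf_neq0 ?gt_eqF.
Qed.

Lemma nrm_fmap_outer x : beta < nrm x -> nrm (f x) = nrm (a * x + b) / nrm x.
Proof.
move=> xb; have x0 := lt_trans beta_gt0 xb.
rewrite nrm_fmap !(uabsBl nrmP)// ?(lt_trans alphabeta)//.
by rewrite -mulf_div divff ?gt_eqF// mul1r.
Qed.

Lemma nrm_fmap_middle x : beta < nrm x -> nrm x < alpha * beta / A ->
  nrm (f x) = alpha * beta / nrm x.
Proof. by move=> xb xp; rewrite nrm_fmap_outer// nrm_numer. Qed.

Lemma nrm_fmap_far x : alpha * beta / A < nrm x -> nrm (f x) = A.
Proof.
move=> xp; have xb := lt_trans beta_lt_pole xp.
have x0 := lt_trans beta_gt0 xb.
rewrite nrm_fmap_outer// (uabsDl nrmP).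
  by rewrite (uabsM nrmP) mulfK ?gt_eqF.
by rewrite nrmb (uabsM nrmP) -ltr_pdivrMl // mulrC.
Qed.

(** Here [a * x] and [b] have equal norm and may cancel, so the ultrametric inequality leaves only
    an upper bound. It still places the image in the open ball of radius [alpha]. *)
Lemma nrm_fmap_critical x : nrm x = alpha * beta / A -> nrm (f x) <= A.
Proof.
move=> xp; have xb : beta < nrm x by rewrite xp.
have x0 := lt_trans beta_gt0 xb.
rewrite nrm_fmap_outer// ler_pdivrMr// (uabsD_le nrmP)//; first by rewrite (uabsM nrmP).
by rewrite nrmb xp mulrCA divff ?gt_eqF// mulr1.
Qed.

(** * Iterates *)

Lemma nrm_iter_small n x : nrm x < alpha -> nrm (iter n f x) = nrm x.
Proof.
by move=> xa; elim: n => //= n IHn; rewrite nrm_fmap_small ?IHn.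
Qed.

(** The first step lands in the open ball of radius [alpha], where all later steps keep the norm. *)
Lemma nrm_iter_outer n x : beta < nrm x -> (1 <= n)%N ->
  nrm (iter n f x) = nrm (f x).
Proof.
case: n => // n xb _; rewrite iterSr nrm_iter_small//.
have x0 := lt_trans beta_gt0 xb.
have [xp|xp|xp] := ltgtP (nrm x) (alpha * beta / A).
- by rewrite nrm_fmap_middle// ltr_pdivrMr// ltr_pM2l.
- by rewrite nrm_fmap_far.
- exact: le_lt_trans (nrm_fmap_critical xp) Aalpha.
Qed.

Lemma sphere0E r x : Sphere nrm r 0 x = (nrm x = r).
Proof. by rewrite /Sphere /= subr0. Qed.

Lemma iter_outer_spheres r x n : nrm x = r -> beta < r -> (1 <= n)%N ->
  [/\ alpha < r -> r < alpha * beta / A ->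
        Sphere nrm (alpha * beta / r) 0 (iter n f x),
      r = alpha * beta / A -> Sphere nrm (nrm (f x)) 0 (iter n f x)
    & alpha * beta / A < r -> Sphere nrm A 0 (iter n f x)].
Proof.
move=> <- xb n1; rewrite !sphere0E nrm_iter_outer//.
by split=> // [_|]; [apply: nrm_fmap_middle | apply: nrm_fmap_far].
Qed.

(** Only the norm of [f x] matters: the earlier estimates are applied to [f x] as a starting point.
    This serves both critical spheres, of radii [alpha] and [beta]. *)
Lemma iter_from_sphere x :
  [/\ nrm (f x) = alpha -> Sphere nrm alpha 0 (f x),
      alpha < nrm (f x) -> nrm (f x) < beta -> Sphere nrm alpha 0 (iter 2 f x),
      nrm (f x) = beta -> Sphere nrm beta 0 (f x)
    & beta < nrm (f x) -> forall n : nat, (2 <= n)%N ->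
      [/\ alpha < nrm (f x) -> nrm (f x) < alpha * beta / A ->
            Sphere nrm (alpha * beta / nrm (f x)) 0 (iter n f x),
          nrm (f x) = alpha * beta / A ->
            Sphere nrm (nrm (f (f x))) 0 (iter n f x)
        & alpha * beta / A < nrm (f x) -> Sphere nrm A 0 (iter n f x)]].
Proof.
split; rewrite ?sphere0E//; first exact: nrm_fmap_annulus.
by move=> fb [//|n] n2; rewrite iterSr; apply: iter_outer_spheres.
Qed.

(** * The maximal Siegel disk at 0 *)

Lemma fmap_siegel_disk0 : is_siegel_disk nrm Z f 0 alpha.
Proof.
have nZ x : nrm x < alpha -> ~ Z x.
  move=> xa; have xb := lt_trans xa alphabeta.
  by case=> xE; [move: xa | move: xb]; rewrite xE ltxx.
split=> //; first by split; [apply: nZ; rewrite uabs0 | exact: fmap0].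
move=> rho _ rhoa x; rewrite !sphere0E => xr.
have xa : nrm x < alpha by rewrite xr.
by split; [exact: nZ | rewrite nrm_fmap_small].
Qed.

Lemma fmap_SI0 : SI nrm Z f 0 = Uball nrm alpha 0.
Proof.
apply/seteqP; split=> x; last by exists alpha => //; exact: fmap_siegel_disk0.
case=> r [_ r0 inv] xr; apply: (lt_le_trans xr); rewrite leNgt.
(* A Siegel disk of radius above [alpha] would make the sphere of radius [alpha] invariant, yet that
   sphere contains the pole [xh1]. *)
apply/negP => /(inv _ alpha_gt0) /(_ xh1); rewrite sphere0E => -[//|].
by case; left.
Qed.

(** * Expansion around the fixed point [x2] *)

Lemma nrm_x2 : nrm x2 = beta.
Proof. by rewrite /x2 (uabsBr nrmP) nrmd. Qed.

(** This turns the regularity assumption on the coefficients into the statement that [x2] is not a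
    pole. *)
Lemma denom_x2 : (x2 - xh1) * (x2 - xh2) = b + a * (a - d).
Proof. by rewrite /x2 /b /d; ring. Qed.

Lemma fmap_sub_x2 x : (x - xh1) * (x - xh2) != 0 ->
  f x - x2 = (x - x2) * ((d * x + b) / ((x - xh1) * (x - xh2))).
Proof.
rewrite mulf_eq0 negb_or => /andP[? ?].
by rewrite fmap_factored /x2 /b /d; field; apply/andP.
Qed.

Section NearX2.
Variable x : K.
Hypothesis xx2 : nrm (x - x2) < beta.

Lemma nrm_near_x2 : nrm x = beta.
Proof. by rewrite -(subrK x2 x) (uabsDr nrmP) nrm_x2. Qed.

(** The term [d * x] has norm [beta ^+ 2] and dominates [b], of norm [alpha * beta]. *)
Lemma nrm_numer_x2 : nrm (d * x + b) = beta ^+ 2.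
Proof.
have ndx : nrm (d * x) = beta ^+ 2.
  by rewrite (uabsM nrmP) nrmd nrm_near_x2 expr2.
by rewrite (uabsDl nrmP) ndx// nrmb expr2 ltr_pM2r.
Qed.

Lemma nrm_denom_x2 : nrm ((x - xh1) * (x - xh2)) < beta ^+ 2.
Proof.
rewrite (uabsM nrmP) (uabsBl nrmP) nrm_near_x2// expr2 ltr_pM2l//.
have -> : x - xh2 = (x - x2) + (a + xh1) by rewrite /x2 /d; ring.
by rewrite (uabsD_lt nrmP)// (uabsD_lt nrmP).
Qed.

Lemma nrm_multiplier_gt1 : (x - xh1) * (x - xh2) != 0 ->
  1 < nrm ((d * x + b) / ((x - xh1) * (x - xh2))).
Proof.
move=> D0; rewrite (uabs_div nrmP) nrm_numer_x2 ltr_pdivlMr ?mul1r.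
  exact: nrm_denom_x2.
by rewrite (uabs_gt0 nrmP).
Qed.

End NearX2.

Let denom_neq0 x : ~ Z x -> (x - xh1) * (x - xh2) != 0.
Proof.
move=> nZ; rewrite mulf_eq0 !subr_eq0; apply/norP.
by split; apply/eqP => e; apply: nZ; [left | right].
Qed.

Let not_pole x : (x - xh1) * (x - xh2) != 0 -> ~ Z x.
Proof. by move=> D0 [] xE; move: D0; rewrite xE !subrr ?mul0r ?mulr0 eqxx. Qed.

Lemma fmap_expands x : nrm (x - x2) < beta -> ~ Z x -> x != x2 ->
  nrm (x - x2) < nrm (f x - x2).
Proof.
move=> xx2 /denom_neq0 D0 x_neq; rewrite fmap_sub_x2// (uabsM nrmP).
by rewrite ltr_pMr ?nrm_multiplier_gt1// (uabs_gt0 nrmP) subr_eq0.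
Qed.

(** * The derivative at [x2] *)

Hypothesis x2_regular : b + a * (a - d) != 0.

Let D2 := (x2 - xh1) * (x2 - xh2).

Let D2_neq0 : D2 != 0.
Proof. by rewrite /D2 denom_x2. Qed.

Lemma fmap_x2 : is_fixed_point Z f x2.
Proof.
split; first exact: not_pole.
by apply/eqP; rewrite -subr_eq0 fmap_sub_x2// subrr mul0r.
Qed.

(** As [2 x2 + d = x2 + a], shifting by [h] adds [h * (x2 + (a + h))] to [D2]. This increment has
    norm [nrm h * beta], which the second bound on [h] keeps below [nrm D2]. *)
Lemma nrm_denom_shift h : nrm h < beta -> nrm h * beta < nrm D2 ->
  nrm ((x2 + h - xh1) * (x2 + h - xh2)) = nrm D2.
Proof.
move=> hb hD.
have -> : (x2 + h - xh1) * (x2 + h - xh2) = D2 + h * (x2 + (a + h)).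
  by rewrite /D2 /x2 /d; ring.
rewrite (uabsDl nrmP)// (uabsM nrmP) (uabsDl nrmP) ?nrm_x2//.
exact: uabsD_lt.
Qed.

(** A Lipschitz bound at [x2] for the expansion factor of [fmap_sub_x2]. Over the common denominator
    [D * D2], of norm [nrm D2 ^+ 2], the numerator is [h] times a difference of two terms of norm at
    most [beta ^+ 3]. *)
Lemma multiplier_shift h : nrm h < beta -> nrm h * beta < nrm D2 ->
  nrm ((d * (x2 + h) + b) / ((x2 + h - xh1) * (x2 + h - xh2))
       - (d * x2 + b) / D2) <= nrm h * (beta ^+ 3 / nrm D2 ^+ 2).
Proof.
move=> hb hD; have nD := nrm_denom_shift hb hD.
set D := _ * _ in nD *.
have D_neq0 : D != 0 by rewrite -(uabs_gt0 nrmP) nD (uabs_gt0 nrmP).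
have -> : (d * (x2 + h) + b) / D - (d * x2 + b) / D2 =
    h * ((d * D2 - (d * x2 + b) * (x2 + (a + h))) / (D * D2)).
  have -> : h * ((d * D2 - (d * x2 + b) * (x2 + (a + h))) / (D * D2)) =
      ((d * (x2 + h) + b) * D2 - (d * x2 + b) * D) / (D * D2).
    by rewrite mulrA; congr (_ / _); rewrite /D /D2 /x2 /d; ring.
  by field; apply/andP.
rewrite (uabsM nrmP) ler_wpM2l ?(uabs_ge0 nrmP)//.
rewrite (uabs_div nrmP) (uabsM nrmP D) nD -expr2.
rewrite ler_wpM2r ?invr_ge0 ?exprn_ge0 ?(uabs_ge0 nrmP)//.
have x2b : nrm (x2 - x2) < beta by rewrite subrr (uabs0 nrmP).
apply: (uabsD_le nrmP).
  rewrite (uabsM nrmP) nrmd exprS ler_pM2l//.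
  exact: ltW (nrm_denom_x2 x2b).
rewrite (uabsN nrmP) (uabsM nrmP) nrm_numer_x2// (exprSr beta 2).
rewrite (uabsDl nrmP) ?nrm_x2//.
exact: uabsD_lt.
Qed.

(** By [fmap_sub_x2], the difference quotient at [x2] is exactly the expansion factor at [x2 + h],
    so its continuity at [x2] suffices. *)
Lemma fmap_derivative_x2 : has_derivative nrm Z f x2 ((d * x2 + b) / D2).
Proof.
move=> e e0; set M := beta ^+ 3 / nrm D2 ^+ 2.
have nD2 : 0 < nrm D2 by rewrite (uabs_gt0 nrmP).
have M0 : 0 < M by rewrite divr_gt0 ?exprn_gt0.
(* The first two bounds are those required by [multiplier_shift]; the third brings its Lipschitz
   estimate below [e]. *)
exists (Num.min beta (Num.min (nrm D2 / beta) (e / M))).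
  by rewrite !lt_min beta_gt0 /=; apply/andP; split; apply: divr_gt0.
move=> h h0; rewrite !lt_min (ltr_pdivlMr _ _ beta_gt0).
rewrite (ltr_pdivlMr _ _ M0) => /and3P[hb hD he].
have D_neq0 : (x2 + h - xh1) * (x2 + h - xh2) != 0.
  by rewrite -(uabs_gt0 nrmP) nrm_denom_shift.
split; first exact: not_pole.
rewrite fmap_x2.2 fmap_sub_x2// addrAC subrr add0r (mulrC h) mulfK//.
exact: le_lt_trans (multiplier_shift hb hD) he.
Qed.

Lemma fmap_repeller_x2 : is_repeller nrm Z f x2.
Proof.
split; first exact: fmap_x2.
exists ((d * x2 + b) / D2); first exact: fmap_derivative_x2.
by apply: nrm_multiplier_gt1 => //; rewrite subrr (uabs0 nrmP).
Qed.

End QuadraticMap.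

Theorem theorem5 (R : realType) (p : nat) (p_prime : prime p)
    (Cp : fieldType) (nrm : Cp -> R) (Cp_def : is_padic_complex p nrm)
    (a b d xh1 xh2 : Cp) (ab_neq0 : a * b != 0) (a_neq_d : a != d)
    (roots : 'X^2 + d *: 'X + b%:P = ('X - xh1%:P) * ('X - xh2%:P))
    (x2_regular : b + a * (a - d) != 0) :
  let f := fmap a b d in
  let Z := [set xh1; xh2] in
  let P := singular_orbits Z f in
  let S := fun r : R => Sphere nrm r 0 in
  let alpha := nrm xh1 in
  let beta := nrm xh2 in
  let A := nrm a in
  let x2 := a - d in
  A < alpha -> alpha < beta ->
  (* 1 *)
  SI nrm Z f 0 = Uball nrm alpha 0 /\
  (* 2 *)
  (forall (r : R) (x : Cp), (S r `\` P) x ->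
     alpha < r -> r < beta -> S alpha (f x)) /\
  (* 3 *)
  (forall (r : R) (x : Cp), (S r `\` P) x -> beta < r ->
     forall n : nat, (1 <= n)%N ->
     [/\ alpha < r -> r < alpha * beta / A ->
           S (alpha * beta / r) (iter n f x),
         r = alpha * beta / A -> S (nrm (f x)) (iter n f x)
       & alpha * beta / A < r -> S A (iter n f x)]) /\
  (* 4 *)
  (forall x : Cp, (S alpha `\` P) x ->
     [/\ nrm (f x) = alpha -> S alpha (f x),
         alpha < nrm (f x) -> nrm (f x) < beta -> S alpha (iter 2 f x),
         nrm (f x) = beta -> S beta (f x)
       & beta < nrm (f x) -> forall n : nat, (2 <= n)%N ->
         [/\ alpha < nrm (f x) -> nrm (f x) < alpha * beta / A ->
               S (alpha * beta / nrm (f x)) (iter n f x),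
             nrm (f x) = alpha * beta / A -> S (nrm (f (f x))) (iter n f x)
           & alpha * beta / A < nrm (f x) -> S A (iter n f x)]]) /\
  (* 5 *)
  (forall x : Cp, (S beta `\` P) x ->
     [/\ nrm (f x) = alpha -> S alpha (f x),
         alpha < nrm (f x) -> nrm (f x) < beta -> S alpha (iter 2 f x),
         nrm (f x) = beta -> S beta (f x)
       & beta < nrm (f x) -> forall n : nat, (2 <= n)%N ->
         [/\ alpha < nrm (f x) -> nrm (f x) < alpha * beta / A ->
               S (alpha * beta / nrm (f x)) (iter n f x),
             nrm (f x) = alpha * beta / A -> S (nrm (f (f x))) (iter n f x)
           & alpha * beta / A < nrm (f x) -> S A (iter n f x)]]) /\
  (* 6 *)
  S beta x2 /\
  is_repeller nrm Z f x2 /\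
  (forall x : Cp, (Uball nrm beta x2 `\` P) x -> x != x2 ->
     nrm (x - x2) < nrm (f x - x2)).
Proof.
have nrmP := padic_complex_ultrametric Cp_def.
(* The coefficients are replaced by their expressions in the roots, the form in which the map was
   studied. *)
move: x2_regular ab_neq0; have [-> -> {roots}] := monic_quadratic_coefs roots.
move=> x2_reg; rewrite mulf_eq0 negb_or => /andP[a0 _] /= Aalpha alphabeta.
have sphere x r : Sphere nrm r 0 x -> nrm x = r by rewrite sphere0E.
split; first exact: fmap_SI0.
split.
  move=> r x [/sphere <- _] ? ?; rewrite sphere0E; exact: nrm_fmap_annulus.
split.
  move=> r x [/sphere xr _] rb n n1; exact: iter_outer_spheres.
split; first by move=> x _; exact: iter_from_sphere.
split; first by move=> x _; exact: iter_from_sphere.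
split; first by rewrite sphere0E; exact: nrm_x2.
split; first exact: fmap_repeller_x2.
move=> x [xx2 nP] x_neq; apply: fmap_expands => //.
(* A pole belongs to [P] through its zeroth iterate. *)
by move=> Zx; apply: nP; exists 0.
Qed.
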